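(* Let $k\ge1$ be an integer, let $S\subset(0,1)$ be open, and suppose $f:S\to[0,1]$ has a simulation on $S$ such that the number of inputs needed $N$ has finite $k$th moment on $S$ (i.e. $\mathbf{E}_pN^k<\infty$ for all $p\in S$), and furthermore the tails of the moments decrease uniformly: $\lim_{n\to\infty}\mathbf{E}_p\big[N^k\mathbf{1}(N>n)\big]=0$ uniformly in $p\in S$. Then $f\in C^k(S)$, i.e. $f$ has $k$ continuous derivatives on $S$.
   Context: For $p\in[0,1]$ let $\mathbf{P}_p$ (with expectation $\mathbf{E}_p$) be the law of an infinite sequence $X_1,X_2,\ldots$ of i.i.d. $\{0,1\}$-valued random variables (''$p$-coin tosses'') with $\mathbf{P}_p(X_i=1)=p$. An algorithm consists of a stopping time $N$ (values in $\{0,1,2,\ldots\}\cup\{\infty\}$) with respect to the natural filtration of $(X_i)_{i\ge1}$, and a $\{0,1\}$-valued output which, on $\{N<\infty\}$, is a function of $(X_1,\ldots,X_N)$ only; no randomness other than the tosses is used, and the algorithm does not depend on $p$. $N$ is the number of inputs needed. The algorithm simulates a function $f:S\to[0,1]$ on $S\subset[0,1]$ (is a simulation of $f$ on $S$) if for every $p\in S$ we have $\mathbf{P}_p(N<\infty)=1$ and $\mathbf{P}_p(\text{output}=1)=f(p)$. *)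

(* Defs.v *)
From HB Require Import structures.
From mathcomp Require Import all_boot all_order all_algebra finmap.
From mathcomp Require Import all_classical all_reals all_analysis.

Set Implicit Arguments.
Unset Strict Implicit.
Unset Printing Implicit Defensive.

Import Order.TTheory GRing.Theory Num.Theory.
Import numFieldNormedType.Exports.

Local Open Scope classical_set_scope.
Local Open Scope ring_scope.

Section CoinTosses.
Context {R : realType} {d : measure_display} {Omega : measurableType d}.
(* Indices are shifted: X 0 is the first toss. *)
Variable X : nat -> {mfun Omega >-> bool}.

(* Every subset of bool is measurable, so B ranges over all of them. *)
Definition mutually_independent (P : probability Omega R) : Prop :=
  forall (J : {fset nat}) (B : nat -> set bool),
    P (\bigcap_(i in [set` J]) (X i @^-1` B i)) =
    (\prod_(i <- J) P (X i @^-1` B i))%E.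

Definition iid_coin_tosses (p : R) (P : probability Omega R) : Prop :=
  (forall i, P (X i @^-1` [set true]) = p%:E) /\ mutually_independent P.

Definition natural_filtration (n : nat) : set (set Omega) :=
  g_sigma_preimage (fun i : 'I_n => X i : Omega -> bool).

(* Random times take values in option nat, None standing for infinity. *)
Definition stopping_time (N : Omega -> option nat) : Prop :=
  forall n, natural_filtration n [set w | oapp (fun m => (m <= n)%N) false (N w)].

Record algorithm := Algorithm {
  inputs_needed : Omega -> option nat;
  output : {mfun Omega >-> bool};
  inputs_needed_stopping : stopping_time inputs_needed;
  output_determined : forall n w w', inputs_needed w = Some n ->
    (forall i, (i < n)%N -> X i w = X i w') -> output w = output w' }.

Definition num_inputs (A : algorithm) (w : Omega) : \bar R :=
  if inputs_needed A w is Some n then (n%:R)%:E else +oo%E.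

Definition simulates (P : R -> probability Omega R) (A : algorithm)
    (f : R -> R) (S : set R) : Prop :=
  forall p, S p ->
    P p [set w | (num_inputs A w < +oo)%E] = 1%E /\
    P p (output A @^-1` [set true]) = (f p)%:E.

Definition input_moment (P : probability Omega R) (A : algorithm) (k : nat) :
  \bar R := (\int[P]_w (num_inputs A w ^+ k))%E.

Definition input_moment_tail (P : probability Omega R) (A : algorithm)
    (k n : nat) : \bar R :=
  (\int[P]_w (num_inputs A w ^+ k *
              (\1_[set w' : Omega | ((n%:R)%:E < num_inputs A w' :> \bar R)%E] w)%:E))%E.

End CoinTosses.

(* For open S only: f is a total function, but derivatives and continuity at
   points of an open S depend only on the restriction of f to S. *)
Definition Ck_on_open {R : realType} (k : nat) (S : set R) (f : R -> R) : Prop :=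
  (forall j p, (j < k)%N -> S p -> derivable (derive1n j f) p 1) /\
  (forall j p, (j <= k)%N -> S p -> {for p, continuous (derive1n j f)}).

(* Main.v *)
Require Import Defs.
From mathcomp Require Import all_boot all_order all_algebra finmap.
From mathcomp Require Import all_classical all_reals all_analysis.
From mathcomp Require Import measurable_realfun.
From mathcomp Require Import ring lra.
Import Order.TTheory GRing.Theory Num.Theory.
Import numFieldNormedType.Exports.
Import HBNNSimple.
Local Open Scope classical_set_scope.
Local Open Scope ring_scope.

(** The accepting event at time n is decided by the first n tosses, so its
    probability is a polynomial in the parameter p, namely a sum of monomials
    p^s (1 - p)^t with s + t = n, one for each accepted word of length n. The
    function f is therefore the pointwise limit of polynomials F_m, the
    probabilities of accepting by time m, and the theorem amounts to the uniform
    convergence, near each point of S, of the derivatives of F_m up to order k.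

    Differentiating p^s (1 - p)^t multiplies it by s / p - t / (1 - p), and the
    result is a combination of two monomials of lower degree. Iterating this
    gives [derivn_bernstein_le]: the j-th derivative is at most
    (n / (p (1 - p)))^j times the monomial, in absolute value. Summing over
    accepted words, the j-th derivative of the n-th term is at most
    (n / (p (1 - p)))^j times the probability of accepting at time n. For
    j <= k the sum of these bounds over the times n with m < n <= M is
    at most (p (1 - p))^(-j) E_p[N^k 1(N > m)]
    ([dist_derivn_partial_poly_le_tail]), and the same tail moment bounds
    |f - F_m| ([dist_partial_poly_le_tail]). Since p (1 - p) is bounded away
    from 0 near each point of the open set S, the uniform decay of the tails
    makes all derivatives up to order k locally uniformly Cauchy, and the
    classical theorem on differentiating limits ([is_derive_uniform_limit],
    iterated in [Ck_on_open_poly_limit]) applies. *)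

(** * Derivatives of Bernstein monomials *)

Lemma deriv_bernstein (R : comNzRingType) (s t : nat) :
  ('X^s * (1 - 'X) ^+ t : {poly R})^`() =
  ('X^(s.-1) * (1 - 'X) ^+ t) *+ s - ('X^s * (1 - 'X) ^+ t.-1) *+ t.
Proof.
rewrite derivM derivXn deriv_exp derivB derivX -polyC1 derivC sub0r.
by rewrite mulN1r mulNrn mulrN mulrnAl mulrnAr.
Qed.

(** Induction on j: by [deriv_bernstein] one more derivative costs the factor
    s / p + t / (1 - p), which is at most (s + t) / (p (1 - p)). *)
Lemma derivn_bernstein_le (R : realFieldType) (p : R) (j s t : nat) :
  0 < p < 1 ->
  `|('X^s * (1 - 'X) ^+ t : {poly R})^`(j).[p]| <=
  ((s + t)%:R / (p * (1 - p))) ^+ j * (p ^+ s * (1 - p) ^+ t).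
Proof.
move=> /andP[p0 p1]; have q0 : 0 < 1 - p by rewrite subr_gt0.
have pq0 : 0 < p * (1 - p) by rewrite mulr_gt0.
have mono_ge0 s' t' : 0 <= p ^+ s' * (1 - p) ^+ t'.
  by rewrite mulr_ge0 ?exprn_ge0 ?ltW.
elim: j s t => [|j IH] s t.
  by rewrite derivn0 expr0 mul1r !hornerE ger0_norm.
rewrite derivSn deriv_bernstein derivnB !derivnMn hornerD hornerN !hornerMn.
apply: (le_trans (ler_normB _ _)); rewrite !normrMn.
have IH' s' t' : (s' + t' <= s + t)%N ->
    `|('X^s' * (1 - 'X) ^+ t' : {poly R})^`(j).[p]| <=
    ((s + t)%:R / (p * (1 - p))) ^+ j * (p ^+ s' * (1 - p) ^+ t').
  move=> le_n; apply: (le_trans (IH s' t')); apply: ler_wpM2r => //.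
  apply: lerXn2r; rewrite ?nnegrE ?divr_ge0 ?ler0n ?(ltW pq0)//.
  by rewrite ler_pM2r ?invr_gt0// ler_nat.
apply: (@le_trans _ _
    (((s + t)%:R / (p * (1 - p))) ^+ j * (p ^+ s * (1 - p) ^+ t) *
     (s%:R / p + t%:R / (1 - p)))).
  rewrite mulrDr; apply: lerD.
    (* For s = 0 the exponent s.-1 is truncated, but the term has factor s. *)
    case: s IH' => [|s] IH'; first by rewrite mulr0n mul0r mulr0.
    rewrite -[leLHS]mulr_natr /= (le_trans (ler_wpM2r _ (IH' s t _)))// ?leq_add2r//.
    by rewrite exprS le_eqVlt; apply/orP; left; apply/eqP; field; rewrite gt_eqF.
  case: t IH' => [|t] IH'; first by rewrite mulr0n mul0r mulr0.
  rewrite -[leLHS]mulr_natr /= (le_trans (ler_wpM2r _ (IH' s t _)))// ?leq_add2l//.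
  rewrite [(1 - p) ^+ t.+1]exprS le_eqVlt; apply/orP; left; apply/eqP.
  by field; rewrite gt_eqF//= gt_eqF.
rewrite exprSr [leRHS]mulrAC; apply: ler_wpM2l.
  by rewrite mulr_ge0// exprn_ge0// divr_ge0 ?ler0n ?ltW.
rewrite ler_pdivlMr// mulrDl natrD.
have -> : s%:R / p * (p * (1 - p)) = s%:R * (1 - p) by field; rewrite gt_eqF.
have -> : t%:R / (1 - p) * (p * (1 - p)) = t%:R * p by field; rewrite gt_eqF.
by apply: lerD; apply: ler_piMr; rewrite ?ler0n ?gerBl// ltW.
Qed.

(** * Derivatives of locally uniform limits *)

Lemma dist_le_derivative_bound (R : realType) (v dv : R -> R) (p r M : R) :
  (forall x, ball p r x -> is_derive x (1 : R) v (dv x)) ->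
  (forall x, ball p r x -> `|dv x| <= M) ->
  forall y, ball p r y -> `|v y - v p| <= M * `|y - p|.
Proof.
move=> dvP dvM y; rewrite -ball_normE /= => py.
have segment_ball x : `|x - p| <= `|y - p| -> ball p r x.
  by rewrite -ball_normE /= [ `|p - x|]distrC => /le_lt_trans; apply; rewrite distrC.
have mvt a b : a <= b -> (forall x, a <= x <= b -> `|x - p| <= `|y - p|) ->
    `|v b - v a| <= M * `|b - a|.
  move=> ab abp.
  have abd x : x \in `[a, b] -> is_derive x (1 : R) v (dv x).
    by rewrite in_itv /= => /abp /segment_ball; apply: dvP.
  have abo x : x \in `]a, b[ -> is_derive x (1 : R) v (dv x).
    by move=> /subset_itv_oo_cc; apply: abd.
  have abc : {within `[a, b], continuous v}.
    by apply: derivable_within_continuous => x /abd [].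
  have [c] := MVT_segment ab abo abc.
  rewrite in_itv /= => /abp /segment_ball /dvM cM ->.
  by rewrite normrM ler_wpM2r.
have [pley|yltp] := leP p y.
  apply: mvt => // x /andP[px xy].
  by rewrite !ger0_norm ?subr_ge0// lerD2r.
rewrite distrC [ `|y - p|]distrC; apply: mvt; first exact: ltW.
move=> x /andP[yx xp].
by rewrite distrC [ `|y - p|]distrC !ger0_norm ?subr_ge0 ?lerD2l ?lerN2// ltW.
Qed.

(** The difference quotients of g and of u n differ by little, uniformly in the
    increment: this is the mean value bound for u m - u n, whose derivative is
    uniformly small, in the limit m -> oo. Then the difference quotient of the
    single function u n is compared with its derivative. *)
Lemma is_derive_uniform_limit (R : realType) (u du : nat -> R -> R)
    (g h : R -> R) (p r : R) :
  0 < r ->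
  (forall n x, ball p r x -> is_derive x (1 : R) (u n) (du n x)) ->
  (forall x, ball p r x -> u n x @[n --> \oo] --> g x) ->
  (forall e, 0 < e -> \forall n \near \oo,
     forall x, ball p r x -> `|du n x - h x| <= e) ->
  is_derive p (1 : R) g (h p).
Proof.
move=> r0 uP ug duh.
have pr : ball p r p by apply: ballxx.
suff cv : t^-1 *: ((g \o shift p) (t *: (1 : R)) - g p) @[t --> 0^'] --> h p.
  by apply: DeriveDef; [apply/cvg_ex; exists (h p)|apply: cvg_lim].
apply/cvgrPdist_le => e e0.
have e40 : 0 < e / 4 by rewrite divr_gt0.
have [n _ duhn] := duh _ e40.
have tails x : ball p r x ->
    `|(g x - g p) - (u n x - u n p)| <= e / 2 * `|x - p|.
  move=> px.
  have cvd : (u m x - u m p) - (u n x - u n p) @[m --> \oo] -->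
      (g x - g p) - (u n x - u n p).
    by apply: cvgB; [apply: cvgB; apply: ug|apply: cvg_cst].
  apply: (cvgr_to_le (cvg_norm cvd)); near=> m.
  have nm : (n <= m)%N by near: m; exact: nbhs_infty_ge.
  have vd y : ball p r y ->
      is_derive y (1 : R) (fun z => u m z - u n z) (du m y - du n y).
    by move=> py; apply: is_deriveB; apply: uP.
  have vd_le y : ball p r y -> `|du m y - du n y| <= e / 2.
    move=> py; have -> : du m y - du n y = (du m y - h y) - (du n y - h y) by ring.
    rewrite (le_trans (ler_normB _ _))//.
    by rewrite [leRHS](_ : _ = e / 4 + e / 4) ?lerD ?duhn//=; field.
  have := @dist_le_derivative_bound _ _ _ p r _ vd vd_le x px.
  have -> : u m x - u n x - (u m p - u n p) =
      u m x - u m p - (u n x - u n p) by ring.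
  by [].
have : t^-1 *: ((u n \o shift p) (t *: (1 : R)) - u n p) @[t --> 0^'] --> du n p.
  by have [d <-] := uP n p pr; exact: d.
move=> /cvgrPdist_le /(_ _ e40) un'; near=> t.
have t0 : t != 0 by near: t; exact: nbhs_dnbhs_neq.
have tr : ball p r (t + p).
  rewrite -ball_normE /= opprD addrCA subrr addr0 normrN.
  by near: t; apply: dnbhs0_lt.
have := tails _ tr; rewrite addrK => tails_t.
have un'_t : `|du n p - t^-1 *: ((u n \o shift p) (t *: (1 : R)) - u n p)| <= e / 4.
  by near: t.
have duh_p : `|du n p - h p| <= e / 4 by apply: (duhn n) => /=.
move: un'_t; rewrite /= /GRing.scale /= mulr1 => un'_t.
have -> : h p - t^-1 * (g (t + p) - g p) =
  - (du n p - h p) + (du n p - t^-1 * (u n (t + p) - u n p))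
  - t^-1 * ((g (t + p) - g p) - (u n (t + p) - u n p)) by ring.
rewrite (le_trans (ler_normB _ _))//.
rewrite [leRHS](_ : _ = e / 4 + e / 4 + e / 2); last by field.
apply: lerD.
  by rewrite (le_trans (ler_normD _ _))// normrN lerD.
by rewrite normrM normfV mulrC ler_pdivrMr ?normr_gt0.
Unshelve. all: by end_near.
Qed.

(** The j-th derivative of f on S is the limit G j of the j-th derivatives of
    the polynomials, by induction on j. The uniformity is asked only on a
    neighbourhood of each point, because the bounds available in the
    application degenerate at 0 and 1. *)
Lemma Ck_on_open_poly_limit (R : realType) (k : nat) (S : set R) (f : R -> R)
    (u : nat -> {poly R}) :
  open S ->
  (forall p, S p -> (u n).[p] @[n --> \oo] --> f p) ->
  (forall j p, (j <= k)%N -> S p -> exists2 r, 0 < r &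
     forall e, 0 < e -> \forall n \near \oo, forall m, (n <= m)%N ->
       forall y, ball p r y -> `|(u m)^`(j).[y] - (u n)^`(j).[y]| <= e) ->
  Ck_on_open k S f.
Proof.
move=> openS uf cauchy_u.
pose G j y := lim ((u n)^`(j).[y] @[n --> \oo]).
have uG j y : (j <= k)%N -> S y -> (u n)^`(j).[y] @[n --> \oo] --> G j y.
  move=> jk Sy; apply/cauchy_cvgP; apply: cauchy_exP => e e0.
  have [r r0 /(_ (e / 2))[|n _ un]] := cauchy_u j y jk Sy.
    by rewrite divr_gt0.
  exists (u n)^`(j).[y]; exists n => // m /= nm; rewrite -ball_normE /= distrC.
  rewrite (le_lt_trans (un n _ m nm y _)) ?ltr_pdivrMr ?ltr_pMr ?ltr1n//=.
  exact: ballxx.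
have uniG j p : (j <= k)%N -> S p -> exists2 r, 0 < r & ball p r `<=` S /\
    forall e, 0 < e -> \forall n \near \oo,
      forall y, ball p r y -> `|(u n)^`(j).[y] - G j y| <= e.
  move=> jk Sp; have [r r0 ur] := cauchy_u j p jk Sp.
  have /nbhs_ballP[s /= s0 pS] : nbhs p S by exact: open_nbhs_nbhs.
  exists (Num.min r s); first by rewrite lt_min r0.
  have subS : ball p (Num.min r s) `<=` S.
    by apply: subset_trans pS; apply: le_ball; rewrite ge_min lexx orbT.
  split=> // e e0; have [n0 _ un0] := ur e e0; exists n0 => // n /un0 un y py.
  have cvd : (u m)^`(j).[y] - (u n)^`(j).[y] @[m --> \oo] -->
      G j y - (u n)^`(j).[y].
    by apply: cvgB; [apply: uG => //; exact: subS|apply: cvg_cst].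
  rewrite distrC; apply: (cvgr_to_le (cvg_norm cvd)); exists n => // m /= nm.
  by apply: un => //; apply: le_ball py; rewrite ge_min lexx.
have dG j p : (j < k)%N -> S p -> is_derive p (1 : R) (G j) (G j.+1 p).
  move=> jk Sp; have [r r0 [subS ur]] := uniG j.+1 p jk Sp.
  apply: (@is_derive_uniform_limit _ (fun n => horner (u n)^`(j))
    (fun n => horner (u n)^`(j.+1)) _ _ _ r) => //.
  by move=> x px; apply: uG (ltnW jk) _; exact: subS.
have contG j p : (j <= k)%N -> S p -> {for p, continuous (G j)}.
  move=> jk Sp; have [r r0 [subS ur]] := uniG j p jk Sp.
  apply/cvgrPdist_le => e e0; have e30 : 0 < e / 3 by rewrite divr_gt0.
  have [n _ un0] := ur _ e30; have un := un0 n (leqnn n).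
  have /cvgrPdist_le /(_ _ e30) cn := @continuous_horner _ (u n)^`(j) p.
  near=> y.
  have py : ball p r y by near: y; apply/nbhs_ballP; exists r.
  have -> : G j p - G j y = ((u n)^`(j).[p] - (u n)^`(j).[y])
    - ((u n)^`(j).[p] - G j p) + ((u n)^`(j).[y] - G j y) by ring.
  rewrite [leRHS](_ : _ = e / 3 + e / 3 + e / 3); last by field.
  rewrite (le_trans (ler_normD _ _))// lerD ?un//.
  rewrite (le_trans (ler_normB _ _))// lerD ?un//; last exact: ballxx.
  by near: y.
have eqG j p : (j <= k)%N -> S p -> derive1n j f p = G j p.
  elim: j p => [|j IH] p jk Sp.
    by apply: (cvg_unique _ (uf p Sp)); rewrite //; exact: uG.
  rewrite derive1nS derive1E (@near_eq_derive _ _ _ _ (G j)); last first.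
    have := open_nbhs_nbhs (conj openS Sp); apply: filterS => y Sy.
    by apply: IH => //; exact: ltnW.
  by have [] := dG j p jk Sp.
have near_eqG j p : (j <= k)%N -> S p -> {near p, G j =1 derive1n j f}.
  move=> jk Sp; have := open_nbhs_nbhs (conj openS Sp).
  by apply: filterS => y Sy; rewrite eqG.
split=> j p jk Sp.
  apply: near_eq_derivable (near_eqG j p (ltnW jk) Sp) _.
  by have [] := dG j p jk Sp.
rewrite /prop_for /continuous_at eqG//.
apply: cvg_trans (contG j p jk Sp); apply: near_eq_cvg.
exact: near_eqG.
Unshelve. all: by end_near.
Qed.

(** * A lower bound for integrals *)

(** The integral of a nonnegative function is the supremum of the integrals of
    the simple functions below it, and the weighted sum of indicators is one of
    these. *)
Lemma sum_indic_le_integral (R : realType) (d : measure_display)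
    (T : measurableType d) (mu : {measure set T -> \bar R}) (g : T -> \bar R)
    (I : Type) (s : seq I) (c : I -> R) (E : I -> set T) :
  (forall i, measurable (E i)) -> (forall i, 0 <= c i) ->
  (forall x, (0 <= g x)%E) ->
  (forall x, (((\sum_(i <- s) c i * \1_(E i) x)%R)%:E <= g x)%E) ->
  (\sum_(i <- s) (c i)%:E * mu (E i) <= \int[mu]_x g x)%E.
Proof.
move=> mE c0 g0 le_g.
pose h := \big[@add_nnsfun d T R/@nnsfun0 d T R]_(i <- s)
  scale_nnsfun (indic_nnsfun R (mE i)) (c0 i).
have hE x : h x = \sum_(i <- s) c i * \1_(E i) x.
  rewrite /h; elim: s {le_g h} => [|i s IH]; first by rewrite !big_nil.
  by rewrite !big_cons /= IH.
have -> : (\sum_(i <- s) (c i)%:E * mu (E i) = sintegral mu h)%E.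
  have := integral_nnsfun mu measurableT h; rewrite patch_setT => <-.
  under [RHS]eq_integral do rewrite hE -sumEFin.
  rewrite ge0_integral_sum//; last first.
  - by move=> i x _; rewrite lee_fin mulr_ge0.
  - move=> i; apply/measurable_EFinP; apply: measurable_funM => //.
  apply: eq_bigr => i _; under eq_integral do rewrite EFinM.
  rewrite ge0_integralZl_EFin//; last first.
    by apply/measurable_EFinP.
  by rewrite integral_indic// setIT.
rewrite ge0_integralTE//; apply: ereal_sup_ubound; exists h => //= x.
by rewrite hE.
Qed.

(** * The first tosses *)

Section TossPrefix.
Context {R : realType} {d : measure_display} {Omega : measurableType d}.
Variable X : nat -> {mfun Omega >-> bool}.

Definition toss_prefix (n : nat) (w : Omega) : n.-tuple bool :=
  [tuple X i w | i < n].

Lemma nth_toss_prefix (n : nat) (w : Omega) (i : nat) :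
  (i < n)%N -> nth false (toss_prefix n w) i = X i w.
Proof.
by move=> lt_in; rewrite -[i]/(val (Ordinal lt_in)) -tnth_nth tnth_mktuple.
Qed.

Lemma toss_prefix_eqP (n : nat) (w : Omega) (x : n.-tuple bool) :
  toss_prefix n w = x <-> forall i, (i < n)%N -> X i w = nth false x i.
Proof.
split=> [<- i /nth_toss_prefix -> //|Xx].
by apply: eq_from_tnth => i; rewrite tnth_mktuple Xx// -tnth_nth.
Qed.

Lemma eq_toss_prefixP (n : nat) (w w' : Omega) :
  toss_prefix n w = toss_prefix n w' <-> forall i, (i < n)%N -> X i w = X i w'.
Proof.
rewrite toss_prefix_eqP.
by split=> eqX i lt_in; have := eqX i lt_in; rewrite nth_toss_prefix.
Qed.

Lemma cylinder_bigcap (n : nat) (x : n.-tuple bool) :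
  [set w | toss_prefix n w = x] =
  \bigcap_(i in [set` [fset i in iota 0 n]%fset]) X i @^-1` [set nth false x i].
Proof.
apply/seteqP; split=> w /=.
  by move=> /toss_prefix_eqP Xx i; rewrite /= in_fset /= mem_iota => /Xx.
move=> Xx; apply/toss_prefix_eqP => i lt_in; apply: Xx.
by rewrite /= in_fset /= mem_iota.
Qed.

Lemma measurable_cylinder (n : nat) (x : n.-tuple bool) :
  measurable [set w | toss_prefix n w = x].
Proof.
rewrite cylinder_bigcap; apply: bigcap_measurableType => // i _.
by rewrite -[X in measurable X]setTI; apply: measurable_funP.
Qed.

Lemma cylinder_probability (p : R) (P : probability Omega R) (n : nat)
    (x : n.-tuple bool) :
  iid_coin_tosses X p P ->
  P [set w | toss_prefix n w = x] =
  (p ^+ count_mem true x * (1 - p) ^+ count_mem false x)%:E.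
Proof.
move=> [Xp indep]; rewrite cylinder_bigcap indep.
have toss i b : P (X i @^-1` [set b]) = (if b then p else 1 - p)%:E.
  case: b; first exact: Xp.
  have -> : X i @^-1` [set false] = ~` (X i @^-1` [set true]).
    by apply/seteqP; split => w /=; case: (X i w).
  rewrite probability_setC ?Xp//.
  by rewrite -[X in measurable X]setTI; apply: measurable_funP.
under eq_bigr do rewrite toss.
rewrite (perm_big (iota 0 n)) /=; last first.
  apply: uniq_perm; rewrite ?iota_uniq ?fset_uniq// => i.
  by rewrite in_fset.
rewrite prodEFin; congr (_%:E).
have -> : \prod_(i <- iota 0 n) (if nth false x i then p else 1 - p) =
    \prod_(b <- x) (if b then p else 1 - p).
  by rewrite [RHS](big_nth false) size_tuple /index_iota subn0.
elim: (tval x) => [|b s IH]; first by rewrite big_nil !expr0 mulr1.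
by rewrite big_cons IH; case: b => /=; rewrite add1n add0n exprS; ring.
Qed.

(** Saturated sets form a sigma-algebra that contains the generators. *)
Lemma natural_filtration_saturated (n : nat) (B : set Omega) (w w' : Omega) :
  natural_filtration X n B -> toss_prefix n w = toss_prefix n w' ->
  B w -> B w'.
Proof.
pose sat (B : set Omega) :=
  forall w w', toss_prefix n w = toss_prefix n w' -> B w -> B w'.
move=> XB; suff : sat B by move=> satB eqww'; exact: satB.
move: B XB; apply: smallest_sub.
  split=> [//|B satB|F satF] u u' eq_uu'.
    by move=> [_ nBu]; split=> // Bu'; apply: nBu; exact: satB (esym eq_uu') Bu'.
  by move=> [k _ Fu]; exists k => //; exact: satF eq_uu' Fu.
apply: (big_ind (fun G => G `<=` sat)); first exact: sub0set.
  by move=> G H; rewrite subUset.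
move=> i _ _ [C _ <-] u u' eq_uu' [_ Cu]; split=> //=.
by move/eq_toss_prefixP: eq_uu' => /(_ i (ltn_ord i)) <-.
Qed.

End TossPrefix.

(** * Acceptance probabilities as polynomials *)

Section Acceptance.
Context {R : realType} {d : measure_display} {Omega : measurableType d}.
Context {X : nat -> {mfun Omega >-> bool}} (A : algorithm X).

Definition accepting (n : nat) : set Omega :=
  [set w | inputs_needed A w = Some n /\ output A w].

(** Stopping by time n is decided by the first n tosses, and so is the exact
    stopping time: if w' stopped at an earlier time m, then the first m tosses
    would show that w has stopped by time m as well. *)
Lemma accepting_saturated (n : nat) (w w' : Omega) :
  toss_prefix X n w = toss_prefix X n w' -> accepting n w -> accepting n w'.
Proof.
move=> eq_ww' [Nw out_w].
have stop_le m v v' : toss_prefix X m v = toss_prefix X m v' ->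
    oapp (fun i => (i <= m)%N) false (inputs_needed A v) ->
    oapp (fun i => (i <= m)%N) false (inputs_needed A v').
  exact: (natural_filtration_saturated _ _ _ _ _
    (@inputs_needed_stopping _ _ _ A m)).
have := stop_le n w w' eq_ww'; rewrite Nw /= leqnn => /(_ isT).
case Nw' : (inputs_needed A w') => [m|] //= le_mn.
move/eq_toss_prefixP: eq_ww' => eqX.
have /stop_le : toss_prefix X m w' = toss_prefix X m w.
  by apply/eq_toss_prefixP => i lt_im; rewrite eqX// (leq_trans lt_im).
rewrite Nw' Nw /= leqnn => /(_ isT) le_nm.
split; first by rewrite Nw'; congr Some; apply/eqP; rewrite eqn_leq le_mn.
by rewrite -(output_determined Nw eqX).
Qed.

Definition accepted_word {n : nat} (x : n.-tuple bool) : bool :=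
  `[< exists2 w, accepting n w & toss_prefix X n w = x >].

Lemma accepting_bigcup (n : nat) :
  accepting n = \bigcup_(x in [set` @accepted_word n])
    [set w | toss_prefix X n w = x].
Proof.
apply/seteqP; split=> w.
  by move=> Aw; exists (toss_prefix X n w) => //=; apply/asboolP; exists w.
by move=> [x /asboolP [v Av <-] /esym eq_vw]; exact: accepting_saturated eq_vw Av.
Qed.

Lemma measurable_accepting (n : nat) : measurable (accepting n).
Proof.
rewrite accepting_bigcup; apply: fin_bigcup_measurable => [|x _].
  exact: finite_finset.
exact: measurable_cylinder.
Qed.

Definition accept_poly (n : nat) : {poly R} :=
  \sum_(x : n.-tuple bool | accepted_word x)
    'X^(count_mem true x) * (1 - 'X) ^+ count_mem false x.

Lemma accepting_probability (p : R) (P : probability Omega R) (n : nat) :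
  iid_coin_tosses X p P -> P (accepting n) = ((accept_poly n).[p])%:E.
Proof.
move=> iid; rewrite accepting_bigcup measure_fin_bigcup; last first.
- by move=> x _; exact: measurable_cylinder.
- by move=> x y _ _ [w [/= <- <-]].
- exact: finite_finset.
rewrite -(bigfs _ (index_enum_uniq _)); last by move=> x _; rewrite mem_index_enum.
rewrite /accept_poly horner_sum -sumEFin; apply: eq_bigr => x _.
by rewrite [LHS](cylinder_probability _ _ _ _ _ iid) !hornerE.
Qed.

Definition partial_poly (m : nat) : {poly R} :=
  \sum_(n < m.+1) accept_poly n.

Lemma num_inputs_ge0 (w : Omega) : (0 <= num_inputs A w :> \bar R)%E.
Proof.
by rewrite /num_inputs; case: inputs_needed => [n|]; rewrite ?leey ?lee_fin.
Qed.

(** The accepting events at distinct times are disjoint, and on the one at time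
    n > m the integrand N^k 1(N > m) equals n^k. *)
Lemma sum_accept_poly_le_tail (p : R) (P : probability Omega R) (k m M : nat) :
  iid_coin_tosses X p P ->
  ((\sum_(m.+1 <= n < M) n%:R ^+ k * (accept_poly n).[p])%:E <=
   input_moment_tail P A k m)%E.
Proof.
move=> iid; rewrite -sumEFin.
under eq_bigr do rewrite EFinM -(accepting_probability _ P _ iid).
apply: sum_indic_le_integral.
- exact: measurable_accepting.
- by move=> n; rewrite exprn_ge0.
- by move=> w; rewrite mule_ge0 ?expe_ge0 ?num_inputs_ge0 ?lee_fin.
move=> w; case Nw : (inputs_needed A w) => [n0|]; last first.
  rewrite big1 ?mule_ge0 ?expe_ge0 ?num_inputs_ge0 ?lee_fin// => n _.
  by rewrite indicE memNset ?mulr0// => -[]; rewrite Nw.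
rewrite /num_inputs Nw -EFin_expe -EFinM lee_fin indicE.
have -> : (w \in [set w' | (m%:R%:E < num_inputs A w' :> \bar R)%E]) = (m < n0)%N.
  by apply/idP/idP; rewrite inE /= /num_inputs Nw lte_fin ltr_nat.
(* Only the term of the actual stopping time n0 can be nonzero. *)
apply: (@le_trans _ _ (\sum_(m.+1 <= n < M | n == n0) n%:R ^+ k)); last first.
  rewrite big_nat1_eq; case: ifP => [/andP[-> _]|_]; first by rewrite mulr1.
  by rewrite mulr_ge0// exprn_ge0.
rewrite [leRHS]big_mkcond /=; apply: ler_sum => n _; case: eqVneq => [_|ne].
  by rewrite ler_piMr ?exprn_ge0// indicE lern1 leq_b1.
rewrite indicE memNset ?mulr0// => -[]; rewrite Nw => -[/esym/eqP].
by rewrite (negPf ne).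
Qed.

(** The error is the probability of the event V of output 1 without acceptance
    by time m. There N > m, possibly infinite, hence N^k 1(N > m) >= 1. *)
Lemma dist_partial_poly_le_tail (p q : R) (P : probability Omega R) (k m : nat) :
  iid_coin_tosses X p P -> (0 < k)%N ->
  P (output A @^-1` [set true]) = q%:E ->
  (`|q - (partial_poly m).[p]|%:E <= input_moment_tail P A k m)%E.
Proof.
move=> iid k0 Pout.
pose U := \big[setU/set0]_(n < m.+1) accepting n.
pose V := output A @^-1` [set true] `\` U.
have mU : measurable U.
  by apply: bigsetU_measurable => n _; exact: measurable_accepting.
have mout : measurable (output A @^-1` [set true]).
  by rewrite -[X in measurable X]setTI; exact: measurable_funP.
have mV : measurable V by exact: measurableD.
have PU : P U = (partial_poly m).[p]%:E.
  rewrite measure_bigsetU; first last.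
  - by move=> i j _ _ [w [[+ _] [+ _]]] => -> [].
  - exact: measurable_accepting.
  rewrite /partial_poly horner_sum -sumEFin; apply: eq_bigr => n _.
  by rewrite [LHS](accepting_probability _ _ _ iid).
have subU : U `<=` output A @^-1` [set true].
  by rewrite /U -bigcup_mkord => w [n _ []].
have PV : P V = (q - (partial_poly m).[p])%:E.
  have eqUV : U `|` V = output A @^-1` [set true] by rewrite /V setDUK.
  have UV0 : U `&` V = set0 by rewrite /V setDIK.
  have eq_q : (P U + P V)%E = q%:E.
    by rewrite -Pout -eqUV [RHS](measureU P mU mV UV0).
  by rewrite EFinB -eq_q PU addeAC -EFinB subrr add0e.
rewrite ger0_norm -?lee_fin -PV ?measure_ge0//.
(* Markov's inequality, as a sum over a single index. *)
have := @sum_indic_le_integral _ _ _ P _ _ [:: tt] (fun _ => 1) (fun _ => V).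
rewrite big_seq1 mul1e; apply=> //.
- by move=> w; rewrite mule_ge0 ?expe_ge0 ?num_inputs_ge0 ?lee_fin.
move=> w; rewrite big_seq1 mul1r indicE.
have [|_] := boolP (w \in V); last first.
  by rewrite mule_ge0 ?expe_ge0 ?num_inputs_ge0 ?lee_fin.
rewrite inE => -[out_w]; rewrite /U -bigcup_mkord => nUw.
have lt_m : (m%:R%:E < num_inputs A w :> \bar R)%E.
  rewrite /num_inputs; case Nw : (inputs_needed A w) => [n|]; last exact: ltry.
  rewrite lte_fin ltr_nat ltnNge; apply/negP => le_nm.
  by apply: nUw; exists n.
rewrite indicE mem_set// mule1.
move: lt_m; rewrite /num_inputs; case: inputs_needed => [n|].
  rewrite lte_fin ltr_nat -EFin_expe lee_fin => lt_mn.
  by rewrite exprn_ege1// ler1n (leq_ltn_trans _ lt_mn).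
case: k k0 => // k _ _; rewrite expeS gt0_mulye ?leey//.
by rewrite expe_gt0.
Qed.

(** The factor in [derivn_bernstein_le] depends on a word only through its
    length, so that it comes out of the sum over accepted words. *)
Lemma derivn_accept_poly_le (p : R) (j n : nat) :
  0 < p < 1 ->
  `|(accept_poly n)^`(j).[p]| <=
  (n%:R / (p * (1 - p))) ^+ j * (accept_poly n).[p].
Proof.
move=> p01; rewrite /accept_poly linear_sum !horner_sum mulr_sumr.
apply: (le_trans (ler_norm_sum _ _ _)); apply: ler_sum => x _.
have eq_n : (count_mem true x + count_mem false x)%N = n.
  rewrite -[RHS](size_tuple x) -(count_predC (pred1 true)); congr addn.
  by apply: eq_count => -[].
have := @derivn_bernstein_le _ p j (count_mem true x) (count_mem false x) p01.
by rewrite eq_n !hornerE.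
Qed.

(** The factor (p (1 - p))^j stands on the left so that both sides make sense as
    extended reals without a division. It uses n^j <= n^k for the times n > m. *)
Lemma dist_derivn_partial_poly_le_tail (p : R) (P : probability Omega R)
    (j k m M : nat) :
  iid_coin_tosses X p P -> 0 < p < 1 -> (j <= k)%N -> (m <= M)%N ->
  ((`|(partial_poly M)^`(j).[p] - (partial_poly m)^`(j).[p]|
     * (p * (1 - p)) ^+ j)%:E <= input_moment_tail P A k m)%E.
Proof.
move=> iid p01 le_jk le_mM; have /andP[p0 p1] := p01.
have pq0 : 0 < p * (1 - p) by rewrite mulr_gt0 ?subr_gt0.
apply: le_trans (sum_accept_poly_le_tail p P k m M.+1 iid).
rewrite lee_fin -hornerN -hornerD -derivnB.
have -> : partial_poly M - partial_poly m =
    \sum_(m.+1 <= n < M.+1) accept_poly n :> {poly R}.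
  rewrite /partial_poly -!(big_mkord xpredT accept_poly).
  by rewrite (@big_cat_nat _ _ _ m.+1)//= addrAC subrr add0r.
rewrite linear_sum horner_sum.
apply: (le_trans (ler_wpM2r _ (ler_norm_sum _ _ _))).
  by rewrite exprn_ge0// ltW.
rewrite mulr_suml; apply: ler_sum_nat => n /andP[lt_mn _].
rewrite -ler_pdivlMr ?exprn_gt0//.
apply: (le_trans (derivn_accept_poly_le _ _ _ p01)).
rewrite expr_div_n mulrAC ler_pM2r ?invr_gt0 ?exprn_gt0//.
apply: ler_wpM2r; last by rewrite ler_weXn2l ?ler1n// (leq_ltn_trans _ lt_mn).
(* The bound for j = 0 says that a norm is at most the value. *)
by have := derivn_accept_poly_le p 0 n p01; rewrite expr0 mul1r; apply: le_trans.
Qed.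

End Acceptance.

(** * Smoothness *)

Theorem proposition22 (R : realType) (d : measure_display)
    (Omega : measurableType d) (X : nat -> {mfun Omega >-> bool})
    (P : R -> probability Omega R)
    (hP : forall p : R, 0 <= p <= 1 -> iid_coin_tosses X p (P p))
    (k : nat) (hk : (1 <= k)%N)
    (S : set R) (hS : open S) (hS01 : S `<=` `]0, 1[%classic)
    (f : R -> R) (hf : forall p : R, S p -> 0 <= f p <= 1)
    (hA : exists A : algorithm X,
      [/\ simulates P A f S,
          forall p : R, S p -> (input_moment (P p) A k < +oo)%E &
          forall e : R, 0 < e -> \forall n \near \oo,
            forall p : R, S p -> (input_moment_tail (P p) A k n < e%:E)%E]) :
  Ck_on_open k S f.
Proof.
have [A [simA _ tailA]] := hA.
have S01 p : S p -> 0 < p < 1 by move=> /hS01; rewrite /= in_itv.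
have iid p : S p -> iid_coin_tosses X p (P p).
  by move=> /S01 /andP[p0 p1]; apply: hP; rewrite !ltW.
apply: (@Ck_on_open_poly_limit R k S f (partial_poly A)) => //.
  move=> p Sp; apply/cvgrPdist_le => e e0.
  apply: filterS (tailA e e0) => m /(_ p Sp) /ltW tail_m.
  rewrite -lee_fin; apply: le_trans tail_m.
  by apply: dist_partial_poly_le_tail => //; [exact: iid|exact: (simA p Sp).2].
move=> j p jk Sp; have /andP[p0 p1] := S01 p Sp.
have q0 : 0 < 1 - p by rewrite subr_gt0.
have /nbhs_ballP[s /= s0 pS] : nbhs p S by exact: open_nbhs_nbhs.
(* On the ball of radius r, y >= p / 2 and 1 - y >= (1 - p) / 2, so that
   y (1 - y) >= c. *)
pose r := Num.min s (Num.min (p / 2) ((1 - p) / 2)).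
pose c := p / 2 * ((1 - p) / 2).
have c0 : 0 < c by rewrite !mulr_gt0.
exists r; first by rewrite !lt_min s0 !divr_gt0.
move=> e e0; have cj0 : 0 < c ^+ j by rewrite exprn_gt0.
apply: filterS (tailA (e * c ^+ j) _); last by rewrite mulr_gt0.
move=> m tail_m M le_mM y py.
have Sy : S y by apply: pS; apply: le_ball py; rewrite ge_min lexx.
have y01 := S01 y Sy.
have le_c : c <= y * (1 - y).
  move: py; rewrite -ball_normE /= !lt_min ltr_norml => /and3P[_].
  rewrite !ltr_norml => /andP[_ lt1] /andP[lt2 _].
  by apply: ler_pM; rewrite ?divr_ge0 ?ltW//; lra.
have := dist_derivn_partial_poly_le_tail A y (P y) j k m M (iid y Sy) y01 jk le_mM.
move=> /le_lt_trans /(_ (tail_m y Sy)); rewrite lte_fin => lt_e.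
rewrite -(ler_pM2r cj0) (le_trans _ (ltW lt_e))// ler_wpM2l//.
by rewrite lerXn2r ?nnegrE ?(ltW c0)// (le_trans (ltW c0)).
Qed.
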